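(* For every positive integer $k$, let $$x_k=\Bigl(3,\underbrace{2,\dots,2}_{k\text{ times}};\tfrac{1}{2k+2}\Bigr).$$ Then the achievement set $E(x_k)$ is a Cantorval.
   Context: For an absolutely summable real sequence $x=(x(1),x(2),\dots)$ with infinitely many nonzero terms, its achievement set is $E(x)=\{\sum_{n=1}^\infty \varepsilon_n x(n):\varepsilon_n\in\{0,1\}\}$, the set of all subsums of $\sum_{n=1}^\infty x(n)$. For $q\in(0,\frac12)$, $(k_1,k_2,\dots,k_m;q)$ denotes the (multigeometric) sequence $(k_1,\dots,k_m,k_1q,\dots,k_mq,k_1q^2,\dots,k_mq^2,\dots)$. Thus $x_k$ consists of successive blocks of length $k+1$, the $j$-th block ($j=0,1,2,\dots$) being $3q^j,2q^j,\dots,2q^j$ (with $k$ terms equal to $2q^j$), where $q=\frac{1}{2k+2}$. A Cantorval (more precisely, an $\mathcal{M}$-Cantorval) is a nonempty compact subset $S$ of the real line such that $S$ is the closure of its interior, and both endpoints of any connected component of $S$ with nonempty interior are accumulation points of one-point components of $S$. *)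

(* Defs.v *)
From HB Require Import structures.
From mathcomp Require Import all_boot all_order all_algebra.
From mathcomp Require Import all_classical all_reals all_analysis.
Set Implicit Arguments.
Unset Strict Implicit.
Unset Printing Implicit Defensive.
Import Order.TTheory GRing.Theory Num.Theory.
Import numFieldNormedType.Exports.
Local Open Scope classical_set_scope.
Local Open Scope ring_scope.

(* Sequences are indexed from 0: the term x(n) of the usual notation is
   [x n.-1] here. *)

Definition achievement_set (R : realType) (x : R^nat) : set R :=
  [set s | exists eps : nat -> bool,
     series (fun n => (eps n)%:R * x n) @ \oo --> s].

(* The sequence (k_1, ..., k_m; q), with [ks] = [:: k_1; ...; k_m]. *)
Definition multigeometric (R : realType) (ks : seq R) (q : R) : R^nat :=
  fun n => ks`_(n %% size ks) * q ^+ (n %/ size ks).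

Definition singleton_components (R : realType) (S : set R) : set R :=
  [set x | S x /\ connected_component S x = [set x]].

(* M-Cantorval. When S is compact, its components are compact intervals, so
   [inf] and [sup] below are the two endpoints of the component. *)
Definition cantorval (R : realType) (S : set R) : Prop :=
  [/\ S !=set0,
      compact S,
      closure (interior S) = S &
      forall x, S x -> interior (connected_component S x) !=set0 ->
        limit_point (singleton_components S) (inf (connected_component S x)) /\
        limit_point (singleton_components S) (sup (connected_component S x))].

(* Main.v *)
Require Import Defs.
From HB Require Import structures.
From mathcomp Require Import all_boot all_order all_algebra.
From mathcomp Require Import all_classical all_reals all_analysis.
From mathcomp Require Import zify ring lra.
Import Order.TTheory GRing.Theory Num.Theory.
Import numFieldNormedType.Exports.
Local Open Scope classical_set_scope.
Local Open Scope ring_scope.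

(** Write [N = 2 * k + 2] and let [E] be the achievement set. Choosing terms in
    one block amounts to choosing a digit among [0, 2, 3, ..., N - 1, N + 1], so
    [E] is the set of sums [d_0 + d_1 / N + d_2 / N ^ 2 + ...] with such digits.

    [E] is compact, being a continuous image of the Cantor space
    ([achievement_compact]).

    [E] has interior points. The digits form a complete system of residues
    modulo [N], so every integer of a suitable range is an [n]-digit sum: its
    residue gives the last digit and the quotient is again in the range
    ([three_twos_integer]). Dividing by powers of [N] and passing to the limit,
    [E] contains [3, 4[ ([three_twos_interior]). As [E] is made of small scaled
    copies of itself, it is then the closure of its interior
    ([achievement_regclosed]).

    Endpoints of components. Let a gap of [E] have right end [v]. Then [v] is a
    sum of finitely many terms ([gap_finite_subsum]), and near [v], on the right,
    [E] looks like a small copy of [E] near [0]. Such a copy has holes arbitrarily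
    close to its least point, because [11 / 6] and all its multiples by
    powers of [1 / N] are missing from [E]. Hence [v] is a singleton component
    ([left_gap_end_singleton]). Now gaps accumulate on the left of the infimum of
    any component with interior points, and the right ends of these gaps are the
    required singleton components ([inf_component_limit_point]). The supremum is
    handled by the symmetry of [E] about half of its maximum
    ([sup_component_limit_point]). *)

Set Implicit Arguments.
Unset Strict Implicit.
Unset Printing Implicit Defensive.

(** * Subsums of a summable series *)

Definition subseries {R : realType} (x : R^nat) (eps : nat -> bool) : R^nat :=
  series (fun n => (eps n)%:R * x n).

Definition subsum {R : realType} (x : R^nat) (eps : nat -> bool) : R :=
  limn (subseries x eps).

Definition summable_ge0 {R : realType} (x : R^nat) : Prop :=
  (forall n, 0 <= x n) /\ cvgn (series x).

Lemma subterm_ge0 (R : realType) (x : R^nat) (eps : nat -> bool) n :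
  (forall n, 0 <= x n) -> 0 <= (eps n)%:R * x n.
Proof. by move=> x0; rewrite mulr_ge0// ler0n. Qed.

Lemma is_cvg_subseries (R : realType) (x : R^nat) (eps : nat -> bool) :
  summable_ge0 x -> cvgn (subseries x eps).
Proof.
move=> [x0]; apply: series_le_cvg => // [n|n]; first exact: subterm_ge0.
by case: (eps n); rewrite ?mul1r ?mul0r.
Qed.

Lemma achievement_setE (R : realType) (x : R^nat) :
  summable_ge0 x -> achievement_set x = range (subsum x).
Proof.
move=> sx; apply/seteqP; split=> s /=.
  by move=> [eps es]; exists eps => //; apply: cvg_lim.
by move=> [eps _ <-]; exists eps; apply: is_cvg_subseries.
Qed.

Lemma cvg_subseries (R : realType) (x : R^nat) (eps : nat -> bool) :
  summable_ge0 x -> subseries x eps n @[n --> \oo] --> subsum x eps.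
Proof. by move=> sx; exact: is_cvg_subseries. Qed.

Lemma achievement_subsum (R : realType) (x : R^nat) (eps : nat -> bool) :
  summable_ge0 x -> achievement_set x (subsum x eps).
Proof. by move=> sx; rewrite achievement_setE//; exists eps. Qed.

Lemma subsum_ge0 (R : realType) (x : R^nat) (eps : nat -> bool) :
  summable_ge0 x -> 0 <= subsum x eps.
Proof.
move=> sx; apply: limr_ge; first exact: is_cvg_subseries.
by near=> n; apply: sumr_ge0 => i _; apply: subterm_ge0; case: sx.
Unshelve. all: by end_near. Qed.

Lemma subsum_le (R : realType) (x : R^nat) (eps : nat -> bool) :
  summable_ge0 x -> subsum x eps <= limn (series x).
Proof.
move=> sx; apply: lim_series_le; first exact: is_cvg_subseries.
  by case: sx.
by move=> n; case: (eps n); rewrite ?mul1r ?mul0r//; case: sx.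
Qed.

Lemma series_shift (V : zmodType) (u : V ^nat) n m :
  series u (m + n)%N = series u n + series (fun i => u (n + i)%N) m.
Proof.
rewrite series_addn; congr (_ + _).
have := big_addn 0 (m + n)%N n xpredT u (idx := 0) (op := +%R).
rewrite add0n addnK => ->.
by apply: eq_bigr => i _; rewrite addnC.
Qed.

Lemma summable_ge0_shift (R : realType) (x : R^nat) n :
  summable_ge0 x -> summable_ge0 (fun i => x (n + i)%N).
Proof.
move=> [x0 cx]; split=> //.
have -> : series (fun i => x (n + i)%N) = fun m => series x (m + n)%N - series x n.
  by apply/funext => m; rewrite series_shift addrC addKr.
apply: is_cvgB; last exact: is_cvg_cst.
by apply/cvg_ex; exists (limn (series x)); rewrite cvg_shiftn.
Qed.

(** Cutting a subsum at index [n] leaves a subsum of the shifted sequence; all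
    self-similarity arguments below rest on this. *)
Lemma subsum_split (R : realType) (x : R^nat) (eps : nat -> bool) n :
  summable_ge0 x ->
  subsum x eps = subseries x eps n +
                 subsum (fun i => x (n + i)%N) (fun i => eps (n + i)%N).
Proof.
move=> sx; apply: cvg_lim => //.
rewrite -(cvg_shiftn n).
have -> : (fun m => subseries x eps (m + n)%N) = fun m => subseries x eps n +
   subseries (fun i => x (n + i)%N) (fun i => eps (n + i)%N) m.
  by apply/funext => m; rewrite /subseries series_shift.
apply: cvgD; first exact: cvg_cst.
by apply: cvg_subseries; apply: summable_ge0_shift.
Qed.

Lemma series_tail (R : realType) (x : R^nat) n : summable_ge0 x ->
  limn (series (fun i => x (n + i)%N)) = limn (series x) - series x n.
Proof.
move=> sx; have one y : series y = subseries y (fun=> true) :> R^nat.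
  by rewrite /subseries; congr series; apply/funext => i; rewrite mul1r.
by rewrite !one -/(subsum _ _) -/(subsum _ _) (@subsum_split _ x _ n)// addrC addKr.
Qed.

Lemma dist_subsum_agree (R : realType) (x : R^nat) (eps z : nat -> bool) n :
  summable_ge0 x -> (forall i, (i < n)%N -> z i = eps i) ->
  `|subsum x eps - subsum x z| <= limn (series x) - series x n.
Proof.
move=> sx agree; rewrite -series_tail//.
rewrite (subsum_split eps n)// (subsum_split z n)//.
have -> : subseries x z n = subseries x eps n.
  rewrite /subseries /series/= !big_mkord; apply: eq_bigr => i _.
  by rewrite agree.
have sxn := summable_ge0_shift n sx.
set u := fun i : nat => eps _; set v := fun i : nat => z _.
have := subsum_le u sxn; have := subsum_le v sxn.
have := subsum_ge0 u sxn; have := subsum_ge0 v sxn.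
by move=> *; rewrite ler_norml; lra.
Qed.

(** The achievement set is the image of the Cantor space under [subsum], and
    [subsum] is continuous because selections with a long common prefix differ
    by at most a tail of the series. *)
Lemma achievement_compact (R : realType) (x : R^nat) :
  summable_ge0 x -> compact (achievement_set x).
Proof.
move=> sx; rewrite achievement_setE//.
suff cf : continuous (subsum x : cantor_space -> R).
  apply: (@continuous_compact cantor_space R); last exact: cantor_space_compact.
  exact: continuous_subspaceT.
move=> eps; apply/cvgrPdist_lt => e e0.
have [n tn] : exists n, limn (series x) - series x n < e.
  have := sx.2; move/cvgrPdist_lt => /(_ _ e0) [n _ /(_ n (leqnn n))] /=.
  by move=> h; exists n; apply: le_lt_trans h; apply: ler_norm.
have agree : \forall eps' \near (eps : cantor_space),
    forall i, (i < n)%N -> eps' i = eps i.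
  elim: n {tn} => [|n IH]; first by near=> z.
  have En : \forall z \near (eps : cantor_space), z n = eps n.
    exact: (@proj_continuous _ (fun=> bool) n eps [set eps n]).
  near=> z => i; rewrite ltnS leq_eqVlt => /orP[/eqP ->|]; first by near: z.
  by move: i; near: z.
apply: filterS agree => z zeps; apply: le_lt_trans tn.
by apply: dist_subsum_agree => // i /zeps.
Unshelve. all: by end_near. Qed.

(** Complementing a selection reflects the achievement set about half of the
    total sum, so left and right play the same role. *)
Lemma achievement_sym (R : realType) (x : R^nat) s : summable_ge0 x ->
  achievement_set x s -> achievement_set x (limn (series x) - s).
Proof.
move=> sx [eps es]; exists (fun n => ~~ eps n).
have -> : series (fun n => (~~ eps n)%:R * x n) =
          fun n => series x n - subseries x eps n.
  apply/funext => n; rewrite /subseries /series/= -sumrB.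
  by apply: eq_bigr => i _; case: (eps i) => /=; ring.
by apply: cvgB => //; case: sx.
Qed.

Lemma achievement_remove (R : realType) (x : R^nat) (eps : nat -> bool) n :
  summable_ge0 x ->
  eps n -> achievement_set x (subsum x eps - x n).
Proof.
move=> sx en; exists (fun i => eps i && (i != n)).
have h : \forall m \near \oo, subseries x eps m - x n =
    series (fun i => (eps i && (i != n))%:R * x i) m.
  near=> m.
  have nm : (n < m)%N by near: m; exists n.+1.
  rewrite /subseries /series/= !big_mkord.
  rewrite (bigD1 (Ordinal nm))//= [RHS](bigD1 (Ordinal nm))//= en eqxx/= mul1r mul0r add0r.
  rewrite addrAC subrr add0r; apply: eq_bigr => i; rewrite -val_eqE/= => ->.
  by rewrite andbT.
apply: (cvg_trans (near_eq_cvg h)).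
by apply: cvgB; [apply: cvg_subseries|apply: cvg_cst].
Unshelve. all: by end_near. Qed.

(** If infinitely many terms were selected, deleting one with a large index
    would give a subsum just below the original one, inside the gap. *)
Lemma gap_finite_subsum (R : realType) (x : R^nat) (eps : nat -> bool) w :
  summable_ge0 x -> (forall n, 0 < x n) ->
  w < subsum x eps ->
  (forall s, w <= s < subsum x eps -> ~ achievement_set x s) ->
  exists n, forall i, (n <= i)%N -> eps i = false.
Proof.
move=> sx xgt0 wv gap.
have := cvg_series_cvg_0 sx.2; move/cvgrPdist_lt => /(_ (subsum x eps - w)).
rewrite subr_gt0 => /(_ wv)[n _ nP]; exists n => i ni.
apply/negbTE/negP => ei; have := nP i ni; rewrite /= sub0r normrN gtr0_norm// => xi.
apply: (gap (subsum x eps - x i)); last exact: achievement_remove.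
by have := xgt0 i; lra.
Qed.

Lemma subsum_finite (R : realType) (x : R^nat) (eps : nat -> bool) n :
  (forall i, (n <= i)%N -> eps i = false) -> subsum x eps = subseries x eps n.
Proof.
move=> en; apply: cvg_lim => //; apply: cvg_near_cst.
near=> m; have nm : (n <= m)%N by near: m; exists n.
rewrite /subseries /series/= (big_cat_nat (leq0n n) nm)//= [X in _ + X]big_nat_cond.
rewrite [X in _ + X]big1 ?addr0// => i /andP[/andP[ni _] _].
by rewrite en// mul0r.
Unshelve. all: by end_near. Qed.

(** * Components of compact subsets of the line *)

Lemma closed_inf_mem (R : realType) (A : set R) :
  closed A -> has_inf A -> A (inf A).
Proof.
move=> clA iA; apply: clA => B /nbhs_ballP[e /= e0 Be].
have [y Ay ye] := inf_adherent e0 iA.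
exists y; split=> //; apply: Be; rewrite /ball/= distrC ger0_norm; last first.
  by rewrite subr_ge0; apply: ge_inf => //; case: iA.
by lra.
Qed.

(** The gap lies to the left of [v]. The least point of [S] qualifies, its gap
    being unbounded. *)
Definition left_gap_end (R : realType) (S : set R) (v : R) : Prop :=
  S v /\ exists2 w, w < v & forall s, w <= s < v -> ~ S s.

Lemma component_itv (R : realType) (S : set R) (x y : R) :
  x <= y -> (forall z, x <= z <= y -> S z) -> connected_component S y x.
Proof.
move=> xy xyS; exists `[x, y]%classic; last by rewrite /= in_itv/= lexx.
split; first by rewrite /= in_itv/= lexx andbT.
  by move=> z; rewrite /= in_itv/=; exact: xyS.
exact: segment_connected.
Qed.

(** Every left neighbourhood of the infimum [a] of a component contains a point
    [w] outside [S], since otherwise the component would extend below [a]. The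
    first point [v] of [S] after [w] ends a gap, hence is a singleton component,
    and [v] differs from [a] because the component of [a] is not a singleton. *)
Lemma inf_component_limit_point (R : realType) (S : set R) (x : R) :
  compact S -> left_gap_end S `<=` singleton_components S ->
  S x -> interior (connected_component S x) !=set0 ->
  limit_point (singleton_components S) (inf (connected_component S x)).
Proof.
move=> cS gapS Sx [c /nbhs_ballP[e /= e0 ce]].
have clS := compact_closed (@norm_hausdorff _ _) cS.
set C := connected_component S x.
have CS : C `<=` S by exact: connected_component_sub.
have clC : closed C by exact: component_closed.
have [b lbS] : has_lbound S.
  have [M [_ /(_ (M + 1)) Mb]] := compact_bounded cS.
  exists (- (M + 1)) => y /Mb /= ; rewrite ltrDl ltr01 => /(_ isT).
  by rewrite ler_norml => /andP[].
have iC : has_inf C.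
  by split; [exists x; exact: connected_component_refl | exists b => y /CS /lbS].
have Ca := closed_inf_mem clC iC.
set a := inf C in Ca *.
have lbC y : C y -> a <= y by move=> Cy; apply: ge_inf => //; exists b => z /CS /lbS.
have Cc : C c by apply: ce; exact: ballxx.
have Cc' : C (c + e / 2).
  by apply: ce; rewrite /ball/= opprD addrA subrr add0r normrN gtr0_norm; lra.
move=> U /nbhs_ballP[d /= d0 dU].
have [w wa nSw] : exists2 w, a - d < w < a & ~ S w.
  apply: contrapT => h.
  have SS w : a - d < w < a -> S w by move=> wa; apply: contrapT => nS; apply: h; exists w.
  suff : C (a - d / 2) by move/lbC; lra.
  apply: (connected_component_trans Ca); apply: component_itv; first lra.
  move=> z /andP[z1]; rewrite le_eqVlt => /orP[/eqP ->|za]; first exact: CS.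
  by apply: SS; lra.
pose A := S `&` [set s | w <= s].
have clA : closed A by apply: closedI => //; exact: closed_ge.
have iA : has_inf A.
  by split; [exists a; split => /=; [exact: CS|lra] | exists w => y []].
have [Sv wv] := closed_inf_mem clA iA; set v := inf A in Sv wv.
have va : v <= a.
  by apply: ge_inf; [exists w => y [] | split => /=; [exact: CS|lra]].
have wv' : w < v by rewrite lt_neqAle wv andbT; apply/eqP => wE; apply: nSw; rewrite wE.
have singv : singleton_components S v.
  apply: gapS; split => //; exists w => // s /andP[ws sv] Ss.
  suff : v <= s by lra.
  by apply: ge_inf => //; exists w => y [].
exists v; split => //; last first.
  by apply: dU; rewrite /ball/= ger0_norm; lra.
apply/eqP => vE; case: singv => _; rewrite vE -(same_connected_component Ca) => Ceq.
have CaE y : C y -> y = a by rewrite /C Ceq.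
by have := CaE _ Cc; have := CaE _ Cc'; lra.
Qed.

Lemma component_reflect (R : realType) (S : set R) (T x y : R) :
  (forall s, S s -> S (T - s)) ->
  connected_component S x y -> connected_component S (T - x) (T - y).
Proof.
move=> symS [B [Bx BS Bc] By].
exists [set T - z | z in B]; last by exists y.
split; first by exists x.
  by move=> _ [z /BS Sz <-]; exact: symS.
apply: connected_continuous_connected => //.
apply: continuous_subspaceT => z.
by apply: cvgB; [exact: cvg_cst | exact: cvg_id].
Qed.

Lemma component_reflectE (R : realType) (S : set R) (T x : R) :
  (forall s, S s -> S (T - s)) ->
  connected_component S (T - x) = [set y | connected_component S x (T - y)].
Proof.
move=> symS; apply/seteqP; split => y /= h.
  by have := component_reflect symS h; rewrite subKr.
by have := component_reflect symS h; rewrite subKr.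
Qed.

(** Reflecting about [T / 2] exchanges the suprema and the infima of the
    components and preserves the singleton components. *)
Lemma sup_component_limit_point (R : realType) (S : set R) (T x : R) :
  compact S -> (forall s, S s -> S (T - s)) ->
  left_gap_end S `<=` singleton_components S ->
  S x -> interior (connected_component S x) !=set0 ->
  limit_point (singleton_components S) (sup (connected_component S x)).
Proof.
move=> cS symS gapS Sx [c /nbhs_ballP[e /= e0 ce]].
have CE := component_reflectE x symS.
have iC : interior (connected_component S (T - x)) !=set0.
  exists (T - c); apply/nbhs_ballP; exists e => //= z; rewrite /ball/= => ze.
  rewrite CE /=; apply: ce; rewrite /ball/=.
  by rewrite distrC (_ : T - z - c = T - c - z)//; ring.
have := inf_component_limit_point cS gapS (symS _ Sx) iC.
have -> : inf (connected_component S (T - x)) = T - sup (connected_component S x).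
  have Cx : connected_component S x !=set0.
    by exists x; exact: connected_component_refl.
  have [_ [M Mub]] : has_sup (connected_component S x).
    apply: compact_has_sup => //; apply: (subclosed_compact _ cS).
      by apply: component_closed; exact: compact_closed cS.
    exact: connected_component_sub.
  rewrite CE; apply/eqP; rewrite eq_le; apply/andP; split.
    rewrite lerBrDr -lerBrDl; apply: ge_sup => // y Cy.
    rewrite lerBrDl -lerBrDr; apply: ge_inf; last by rewrite /= subKr.
    by exists (T - M) => z /= /Mub; lra.
  apply: lb_le_inf.
    by case: Cx => y Cy; exists (T - y); rewrite /= subKr.
  move=> z /= Cz; suff : T - z <= sup (connected_component S x) by lra.
  by apply: sup_ubound => //; exists M.
move=> lp U /nbhs_ballP[d /= d0 dU].
have /lp : nbhs (T - sup (connected_component S x)) (ball (T - sup (connected_component S x)) d).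
  exact: nbhsx_ballx.
move=> [y [ynx [Sy sy] yd]]; exists (T - y); split.
- by apply: contra_neq ynx => <-; ring.
- split; first exact: symS.
  rewrite component_reflectE// sy; apply/seteqP; split => z /= zE; lra.
- apply: dU; move: yd; rewrite /ball/= => yd.
  by rewrite distrC (_ : T - y - sup _ = T - sup (connected_component S x) - y)//; ring.
Qed.

(** * Multigeometric sequences *)

Section Multigeometric.
Variables (R : realType) (ks : seq R) (q : R).
Hypotheses (ks_gt0 : forall a, a \in ks -> 0 < a) (size_ks : (0 < size ks)%N).
Hypotheses (q_gt0 : 0 < q) (q_lt1 : q < 1).

Local Notation p := (size ks).
Local Notation x := (multigeometric ks q).
Local Notation E := (achievement_set x).

Lemma multigeometric_shift n i : x (n * p + i)%N = q ^+ n * x i.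
Proof.
rewrite /multigeometric modnMDl divnMDl//.
by rewrite exprD; ring.
Qed.

Lemma multigeometric_gt0 n : 0 < x n.
Proof.
by rewrite mulr_gt0 ?exprn_gt0//; apply/ks_gt0/mem_nth; rewrite ltn_mod.
Qed.

Lemma series_block : series x p = \sum_(a <- ks) a.
Proof.
rewrite (big_nth 0) /series/= !big_mkord; apply: eq_bigr => i _.
by rewrite /multigeometric modn_small// divn_small// expr0 mulr1.
Qed.

Lemma series_shiftZ n m (y : R^nat) :
  series (fun i => q ^+ n * y i) m = q ^+ n * series y m.
Proof. by rewrite /series/= -mulr_sumr. Qed.

Lemma series_multigeometric_le m : series x m <= (\sum_(a <- ks) a) / (1 - q).
Proof.
set s := \sum_(a <- ks) a; have q1 : 0 < 1 - q by rewrite subr_gt0.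
have block n : series x (n * p)%N <= s / (1 - q).
  elim: n => [|n IH].
    rewrite mul0n /series/= big_geq// divr_ge0//; last exact: ltW.
    by rewrite /s big_seq; apply: sumr_ge0 => a /ks_gt0/ltW.
  rewrite mulSn addnC series_shift series_block -/s.
  under eq_fun do rewrite -[X in x (X + _)%N]mul1n multigeometric_shift.
  rewrite series_shiftZ expr1.
  have -> : s / (1 - q) = s + q * (s / (1 - q)) by field; exact: lt0r_neq0.
  by rewrite lerD2l ler_pM2l.
apply: le_trans (block m); apply: nondecreasing_series => //.
  by move=> i _ _; exact/ltW/multigeometric_gt0.
by rewrite leq_pmulr.
Qed.

Lemma multigeometric_summable : summable_ge0 x.
Proof.
split; first by move=> n; exact/ltW/multigeometric_gt0.
apply: nondecreasing_is_cvgn.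
  by apply: nondecreasing_series => i _ _; exact/ltW/multigeometric_gt0.
by exists ((\sum_(a <- ks) a) / (1 - q)) => _ [n _ <-]; exact: series_multigeometric_le.
Qed.

Let sx := multigeometric_summable.

Lemma multigeometric_total : limn (series x) <= (\sum_(a <- ks) a) / (1 - q).
Proof.
apply: limr_le; first by case: sx.
by near=> n; exact: series_multigeometric_le.
Unshelve. all: by end_near. Qed.

(** Self-similarity: after [n] blocks, what remains of a subsum is a subsum of
    the same sequence, scaled by [q ^+ n]. *)
Lemma subsum_blocks (eps : nat -> bool) n :
  subsum x eps = subseries x eps (n * p)%N +
                 q ^+ n * subsum x (fun i => eps (n * p + i)%N).
Proof.
rewrite (subsum_split eps (n * p)%N)//; congr (_ + _).
apply: cvg_lim => //.
have -> : subseries (fun i => x (n * p + i)%N) (fun i => eps (n * p + i)%N) =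
  fun m => q ^+ n * subseries x (fun i => eps (n * p + i)%N) m.
  apply/funext => m; rewrite /subseries -series_shiftZ; congr (series _ m).
  by apply/funext => i; rewrite multigeometric_shift; ring.
by apply: cvgM; [exact: cvg_cst | exact: cvg_subseries].
Qed.

(** Converse of [subsum_blocks]: any choice in the first [n] blocks can be
    followed by any scaled point of the achievement set. *)
Lemma achievement_cat (eps : nat -> bool) n y :
  E y -> E (subseries x eps (n * p)%N + q ^+ n * y).
Proof.
rewrite [in X in X -> _](achievement_setE sx) => -[e _ <-].
pose z i := if (i < n * p)%N then eps i else e (i - n * p)%N.
have -> : subseries x eps (n * p) = subseries x z (n * p).
  rewrite /subseries /series/= !big_mkord; apply: eq_bigr => i _.
  by rewrite /z ltn_ord.
have -> : e = fun i => z (n * p + i)%N.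
  by apply/funext => i; rewrite /z ltnNge leq_addr/= addKn.
by rewrite -subsum_blocks; exact: achievement_subsum.
Qed.

Lemma achievement0 : E 0.
Proof.
exists (fun=> false); apply: cvg_near_cst; near=> n.
by rewrite /series/= big1// => i _; rewrite mul0r.
Unshelve. all: by end_near. Qed.

Lemma achievement_bounds y : E y -> 0 <= y <= limn (series x).
Proof.
rewrite achievement_setE// => -[e _ <-].
by rewrite subsum_ge0// subsum_le.
Qed.

Lemma expr_q_small (e : R) : 0 < e -> \forall n \near \oo, q ^+ n < e.
Proof.
move=> e0; have : q ^+ n @[n --> \oo] --> 0.
  by apply: cvg_expr; rewrite gtr0_norm.
move/cvgrPdist_lt => /(_ e e0).
by apply: filterS => n /=; rewrite sub0r normrN gtr0_norm// exprn_gt0.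
Qed.

(** Each point of the achievement set lies in arbitrarily small scaled copies of
    the whole set, and each of these copies contains an open interval as soon as
    the set itself does. *)
Lemma achievement_regclosed : interior E !=set0 -> closure (interior E) = E.
Proof.
move=> [c /nbhs_ballP[r /= r0 cr]].
have cE : closed E.
  by apply: compact_closed; [exact: norm_hausdorff | exact: achievement_compact].
apply/seteqP; split.
  by move=> y /(closureS (@interior_subset _ E)); rewrite -(closure_id E).1.
move=> s; rewrite [in X in X -> _](achievement_setE sx) => -[eps _ <-].
move=> U /nbhs_ballP[d /= d0 dU].
set L := limn (series x).
have Ec : E c by apply: cr; exact: ballxx.
have /andP[c0 cL] := achievement_bounds Ec.
have L0 : 0 < L + 1 by rewrite -/L in cL; lra.
have [n _ /(_ n (leqnn n)) qn] := expr_q_small (divr_gt0 d0 L0).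
have qn0 : 0 < q ^+ n by rewrite exprn_gt0.
exists (subseries x eps (n * p)%N + q ^+ n * c); split.
  apply/nbhs_ballP; exists (q ^+ n * r) => /=; first exact: mulr_gt0.
  move=> y; rewrite /ball/= => yb.
  have -> : y = subseries x eps (n * p) +
     q ^+ n * ((y - subseries x eps (n * p)) / q ^+ n).
    by rewrite mulrCA divff ?gt_eqF// mulr1 addrC subrK.
  apply: achievement_cat; apply: cr; rewrite /ball/=.
  rewrite -(ltr_pM2l qn0) -{1}(gtr0_norm qn0) -normrM.
  by congr (`|_| < _): yb; field; rewrite gt_eqF.
apply: dU; rewrite /ball/= (subsum_blocks eps n).
set y := subsum _ _; have /andP[y0 yL] : 0 <= y <= L.
  by apply: achievement_bounds; exact: achievement_subsum.
rewrite opprD addrACA subrr add0r -mulrBr normrM gtr0_norm//.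
apply: le_lt_trans (_ : q ^+ n * (L + 1) < _); last by rewrite -ltr_pdivlMr.
by rewrite ler_pM2l// ler_norml; rewrite -/L in cL; lra.
Qed.

End Multigeometric.

(** * Gaps for integer digits *)

(** With integer digits and ratio [1 / N], the sums over the first [n + 1] blocks
    lie on the lattice of step [N ^- n]. *)
Lemma partial_sum_integral (R : realType) (cs : seq nat) (N : nat)
    (eps : nat -> bool) n m :
  (0 < size cs)%N -> (0 < N)%N -> (m <= n.+1 * size cs)%N ->
  exists a : nat, subseries (multigeometric [seq c%:R | c <- cs] N%:R^-1) eps m
                  = a%:R * N%:R^-1 ^+ n :> R.
Proof.
move=> cs0 N0; elim: m => [_|m IH mn].
  by exists 0%N; rewrite /subseries /series/= big_geq// mul0r.
have [a am] := IH (ltnW mn).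
rewrite /subseries /series/= big_nat_recr//=.
rewrite -[X in X + _]/(subseries _ _ _) am /multigeometric size_map.
have jn : (m %/ size cs <= n)%N by rewrite -ltnS ltn_divLR.
exists (a + eps m * (nth 0 cs (m %% size cs) * N ^ (n - m %/ size cs)))%N.
rewrite (nth_map 0%N) ?ltn_mod// !(natrM,natrD) mulrDl natrX; congr (_ + _).
rewrite -!mulrA; congr (_ * (_ * _)).
rewrite -[in RHS](subnK jn) exprD addnK mulrA -exprMn divff ?expr1n ?mul1r//.
by rewrite pnatr_eq0 -lt0n.
Qed.

(** A gap ends at a finite subsum [v], so [v] is on the lattice of step [N ^- n]
    for all large [n]. A point [v + c / N ^ n.+1] of the set would have a prefix
    [e] on that lattice. It cannot be [v] itself because [c] is missing from the
    set; it cannot exceed [v] because [c < N]; and a prefix below [v] is below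
    the whole gap, too far for a small tail to reach [v]. Hence holes accumulate
    at [v] from the right, while the gap isolates [v] from the left. *)
Lemma left_gap_end_singleton (R : realType) (cs : seq nat) (N : nat) (c : R) :
  let E := achievement_set (multigeometric [seq c%:R | c <- cs] N%:R^-1) in
  (0 < size cs)%N -> (1 < N)%N -> (forall a, a \in cs -> (0 < a)%N) ->
  0 < c < N%:R -> ~ E c -> left_gap_end E `<=` singleton_components E.
Proof.
move=> E cs0 N1 cs_gt0 /andP[c0 cN] nEc v [Ev [w wv gap]].
pose ks : seq R := [seq c%:R | c <- cs]; pose q : R := N%:R^-1.
have ks0 : (0 < size ks)%N by rewrite size_map.
have ks_gt0 a : a \in ks -> 0 < a by move=> /mapP[b /cs_gt0 b0 ->]; rewrite ltr0n.
have N0 : 0 < N%:R :> R by rewrite ltr0n; lia.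
have q0 : 0 < q by rewrite invr_gt0.
have q1 : q < 1 by rewrite invf_lt1// ltr1n.
have Nq : N%:R * q = 1 by rewrite divff// gt_eqF.
have sx := multigeometric_summable ks_gt0 ks0 q0 q1.
have x0 := multigeometric_gt0 ks_gt0 ks0 q0.
move: (Ev); rewrite [in X in X -> _]/E (achievement_setE sx) => -[eps _ epsv].
have [n0 fin] : exists n, forall i, (n <= i)%N -> eps i = false.
  by apply: (gap_finite_subsum (w := w) sx) => //; rewrite epsv.
set L := limn (series (multigeometric ks q)).
have L0 : 0 < L + 1.
  by have /andP[] := achievement_bounds ks_gt0 ks0 q0 q1 Ev; rewrite -/L; lra.
have holes : \forall n \near \oo, ~ E (v + c * q ^+ n.+1).
  have := expr_q_small q0 q1 (divr_gt0 (_ : 0 < v - w) L0).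
  rewrite subr_gt0 => /(_ wv) [n1 _ n1P].
  exists (n0 + n1)%N => // n /= nn.
  have qn1 : q ^+ n.+1 * (L + 1) < v - w.
    by rewrite -ltr_pdivlMr//; apply: n1P => /=; lia.
  have qn0 : 0 < q ^+ n.+1 by rewrite exprn_gt0.
  have [a va] : exists a : nat, v = a%:R * q ^+ n.
    have [a aE] := partial_sum_integral R eps cs0 (ltnW N1) (leqnn (n.+1 * size cs)%N).
    exists a; rewrite -aE -epsv; apply: subsum_finite => i ni; apply: fin.
    by apply: leq_trans ni; nia.
  rewrite [E](achievement_setE sx) => -[z _].
  rewrite (subsum_blocks ks_gt0 ks0 q0 q1 z n.+1).
  set y := subsum _ _ => zv.
  have Ey : E y by exact: achievement_subsum.
  have Ee := achievement_cat ks_gt0 ks0 q0 q1 z n.+1 (achievement0 ks q).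
  move: zv Ee; rewrite mulr0 addr0 size_map.
  have [b ->] := partial_sum_integral R z cs0 (ltnW N1) (leqnn (n.+1 * size cs)%N).
  rewrite -/q => zv Ee.
  have /andP[y0 yL] := achievement_bounds ks_gt0 ks0 q0 q1 Ey; rewrite -/L in yL.
  have qnE : q ^+ n = N%:R * q ^+ n.+1 by rewrite exprS mulrA Nq mul1r.
  have eq1 : N%:R * b%:R + y = N%:R * a%:R + c.
    apply: (mulIf (lt0r_neq0 qn0)); move: zv; rewrite va qnE => zv.
    by rewrite !mulrDl; lra.
  have [ba|ab|ab] := ltngtP b a.
  - have : b%:R * q ^+ n < v by rewrite va qnE ltr_pM2r ?ltr_nat// mulr_gt0.
    move=> ev; have [we|ew] := leP w (b%:R * q ^+ n).
      by apply: (gap _ _ Ee); rewrite we.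
    have : q ^+ n.+1 * y <= q ^+ n.+1 * (L + 1) by rewrite ler_pM2l//; lra.
    have : 0 < c * q ^+ n.+1 by rewrite mulr_gt0.
    by lra.
  - have : N%:R * (a%:R + 1) <= N%:R * b%:R :> R.
      by rewrite ler_pM2l// natr1 ler_nat.
    by lra.
  - by apply: nEc; rewrite ab in eq1; rewrite (_ : c = y)//; lra.
split=> //; apply/seteqP; split; last by move=> _ ->; exact: connected_component_refl.
move=> u; have := @component_connected _ E v.
move=> /connected_intervalP itvC Cu.
have Cv : connected_component E v v by exact: connected_component_refl.
have CE : connected_component E v `<=` E by exact: connected_component_sub.
have [uv|vu|//] := ltgtP u v.
- exfalso; pose s := Num.max u w.
  have sv : s < v by rewrite gt_max uv wv.
  apply: (gap s); first by rewrite sv le_max lexx orbT.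
  by apply/CE/(itvC _ _ Cu Cv); rewrite le_max lexx/= ltW.
- exfalso; have uvc : 0 < (u - v) / c by rewrite divr_gt0// subr_gt0.
  have [n2 _ n2P] := expr_q_small q0 q1 uvc.
  case: holes => n1 _ n1P.
  apply: (n1P (n1 + n2)%N); first by rewrite /= leq_addr.
  apply/CE/(itvC _ _ Cv Cu).
  have : q ^+ (n1 + n2).+1 < (u - v) / c by apply: n2P => /=; lia.
  rewrite ltr_pdivlMr// => h.
  have : 0 < c * q ^+ (n1 + n2).+1 by rewrite mulr_gt0// exprn_gt0.
  by lra.
Qed.

(** * The sequence with blocks 3, 2, ..., 2 *)

Section ThreeTwos.
Variables (R : realType) (k : nat).
Hypothesis k_gt0 : (0 < k)%N.

Local Notation N := (2 * k + 2)%N.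
Local Notation cs := (3 :: nseq k 2)%N.
Local Notation ks := ([seq c%:R | c <- cs] : seq R).
Local Notation q := (N%:R^-1 : R).
Local Notation x := (multigeometric ks q).
Local Notation E := (achievement_set x).

Let cs_gt0 c : c \in cs -> (0 < c)%N.
Proof. by rewrite inE => /orP[/eqP ->//|/nseqP[->]]. Qed.

Let ks_gt0 a : a \in ks -> 0 < a.
Proof. by move=> /mapP[b /cs_gt0 b0 ->]; rewrite ltr0n. Qed.

Let ks_size : (0 < size ks)%N. Proof. by []. Qed.

Let N_gt0 : 0 < N%:R :> R. Proof. by rewrite ltr0n; lia. Qed.
Let q_gt0 : 0 < q. Proof. by rewrite invr_gt0. Qed.
Let q_lt1 : q < 1. Proof. by rewrite invf_lt1// ltr1n; lia. Qed.
Let Nq : N%:R * q = 1. Proof. by rewrite divff// gt_eqF. Qed.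

Lemma three_twos_summable : summable_ge0 x.
Proof. exact: multigeometric_summable. Qed.

Let sx := three_twos_summable.

Lemma three_twos_block (eps : nat -> bool) :
  subseries x eps (1 * size ks)%N = (eps 0%N * 3 + 2 * \sum_(0 <= i < k) eps i.+1)%:R.
Proof.
rewrite mul1n /= size_map size_nseq /subseries /series /= big_nat_recl//.
rewrite [RHS]natrD; congr (_ + _).
  by rewrite /multigeometric/= expr0 mulr1 [RHS]natrM.
rewrite [RHS]natrM natr_sum mulr_sumr !big_mkord; apply: eq_bigr => i _.
rewrite /multigeometric /= size_map size_nseq.
rewrite modn_small ?ltnS// divn_small ?ltnS// expr0 mulr1 mulrC.
by rewrite /= (nth_map 0%N) ?size_nseq// nth_nseq ltn_ord.
Qed.

Lemma three_twos_total : limn (series x) <= 5 / 3 * N%:R.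
Proof.
apply: le_trans (multigeometric_total ks_gt0 ks_size q_gt0 q_lt1) _.
have -> : \sum_(a <- ks) a = N%:R + 1 :> R.
  rewrite big_map big_cons -natr_sum big_nseq iter_addn_0.
  by rewrite natr1 -natrD; congr _%:R; lia.
have N4 : 4 <= N%:R :> R by rewrite ler_nat; lia.
rewrite ler_pdivrMr ?subr_gt0//.
have -> : 5 / 3 * N%:R * (1 - q) = 5 / 3 * N%:R - 5 / 3 * (N%:R * q) by ring.
by rewrite Nq; lra.
Qed.

(** A subsum that selects something in the first block is at least [2]; otherwise
    it is at most the total of the later blocks, which is at most [5 / 3]. *)
Lemma three_twos_hole : ~ E (11 / 6).
Proof.
rewrite [E](achievement_setE sx) => -[eps _].
rewrite (subsum_blocks ks_gt0 ks_size q_gt0 q_lt1 eps 1) three_twos_block expr1.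
set y := subsum _ _ => yE.
have /andP[y0 yL] : 0 <= y <= limn (series x).
  apply: (achievement_bounds ks_gt0 ks_size q_gt0 q_lt1).
  exact: achievement_subsum.
have qy0 : 0 <= q * y by rewrite mulr_ge0// ltW.
have qyL : q * y <= 5 / 3.
  by rewrite mulrC -(ler_pM2r N_gt0) -mulrA [q * _]mulrC Nq mulr1 (le_trans yL three_twos_total).
case: (eps 0%N) yE => /= yE.
  have : (3%:R : R) <= (1 * 3 + 2 * \sum_(0 <= i < k) eps i.+1)%:R by rewrite ler_nat; lia.
  by lra.
case: (posnP (\sum_(0 <= i < k) eps i.+1)%N) yE => [->|s_gt0] yE.
  by move: yE; rewrite muln0; lra.
have : (2%:R : R) <= (0 * 3 + 2 * \sum_(0 <= i < k) eps i.+1)%:R by rewrite ler_nat; lia.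
by lra.
Qed.

(** The sums over one block are the integers from [0] to [N + 1] except [1] and
    [N]: even sums avoid the term [3] and odd sums use it. They represent each
    residue modulo [N] exactly once, [1] being represented by [N + 1]. *)
Lemma three_twos_digit d y : (d <= N.+1)%N -> d != 1%N -> d != N ->
  E y -> E (d%:R + q * y).
Proof.
move=> dN d1 dN' Ey.
pose l := ((d - 3 * odd d) %/ 2)%N.
pose eps i := if i is j.+1 then (j < l)%N else odd d.
have lk : (l <= k)%N by rewrite /l; lia.
have dE : d = (eps 0 * 3 + 2 * \sum_(0 <= i < k) eps i.+1)%N.
  have -> : (\sum_(0 <= i < k) eps i.+1 = l)%N.
    rewrite -[RHS](minn_idPr lk); elim: k => [|j IH]; first by rewrite big_geq// min0n.
    by rewrite big_nat_recr//= IH; lia.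
  by rewrite /= /l; lia.
have := achievement_cat ks_gt0 ks_size q_gt0 q_lt1 eps 1 Ey.
by rewrite three_twos_block -dE expr1.
Qed.

(** The integers [m] of the range indicated are sums of [n] base-[N] digits of the
    kind described above. To represent [m] with one more digit, the residue of
    [m] modulo [N] forces the last digit [d], and [f := (m - d) / N] again falls
    in the range. The bounds satisfy [a' = N a + 2] and [b' = N b + N - 1]: the
    largest digit [N + 1] is needed only when [m] is [1] modulo [N], and then [m]
    exceeds [N a + 2] by at least [N - 1]. The free tail [y] lets the digit be
    appended at the end of the expansion. *)
Lemma three_twos_integer n m : (2 * \sum_(i < n) N ^ i <= m < N ^ n)%N ->
  forall y, E y -> E ((m%:R * N%:R + y) * q ^+ n).
Proof.
elim: n m => [|n IH] m.
  rewrite big_ord0 expn0 => m0 y Ey.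
  have -> : m = 0%N by lia.
  by rewrite mul0r add0r expr0 mulr1.
rewrite big_ord_recl expn0 expnS => mb y Ey.
have [f [d [mE dN d1 dN' fb]]] : exists f d, [/\ m = (N * f + d)%N, (d <= N.+1)%N,
    d != 1%N, d != N & (2 * \sum_(i < n) N ^ i <= f < N ^ n)%N].
  move: mb; rewrite (_ : \sum_(i < n) _ = N * \sum_(i < n) N ^ i)%N; last first.
    by rewrite big_distrr; apply: eq_bigr => i _; exact: expnS.
  set S := (\sum_(i < n) _)%N; set P := (N ^ n)%N => /andP[mS mP].
  have := divn_eq m N; have : (m %% N < N)%N by rewrite ltn_mod; lia.
  set t := (m %/ N)%N; set r := (m %% N)%N => rN mE.
  have N4 : (4 <= N)%N by lia.
  move: mE rN mS mP; rewrite -/P; move: N4; set M := N => M4 mE rM mS mP.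
  have cancel a b : (M * a < M * b -> a < b)%N by rewrite ltn_mul2l => /andP[].
  (* The residue 1 is carried by the digit N + 1, at the cost of a borrow. *)
  have [r1|r1] := eqVneq r 1%N.
    have tf : t = t.-1.+1 by case: t mE => [|//]; lia.
    move: mE; rewrite r1 tf; set f := t.-1 => mE.
    exists f, M.+1; split; [lia|lia|lia|lia|].
    by apply/andP; split; [rewrite -ltnS|]; apply: cancel; lia.
  exists t, r; split; [lia|lia|lia|lia|].
  by apply/andP; split; [rewrite -ltnS|]; apply: cancel; lia.
have -> : (m%:R * N%:R + y) * q ^+ n.+1 = (f%:R * N%:R + (d%:R + q * y)) * q ^+ n.
  rewrite exprS mulrA; congr (_ * _); rewrite mE natrD natrM.
  rewrite mulrDl -mulrA Nq mulr1; ring.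
by apply: IH => //; exact: three_twos_digit.
Qed.

(** The lower end of the range, divided by [N ^ n], stays below
    [2 / (N - 1)], and the upper end tends to [1]. After rescaling by [N] the
    finite sums are [N / N ^ n]-dense in [3, 4[, as [2 * N / (N - 1) < 3] and
    [4 <= N], and the set is closed. *)
Lemma three_twos_interior y : 3 <= y < 4 -> E y.
Proof.
move=> /andP[y3 y4].
have N4 : (4 <= N)%N by lia.
have cE : closed E.
  by apply: compact_closed; [exact: norm_hausdorff | exact: achievement_compact].
pose m n := Num.trunc (y * N%:R ^+ n / N%:R).
have yN n : 0 <= y * N%:R ^+ n / N%:R.
  by rewrite divr_ge0 ?ler0n// mulr_ge0 ?exprn_ge0 ?ler0n//; lra.
apply: (@closed_cvg _ _ \oo _ (fun n => (m n)%:R * N%:R * q ^+ n) E cE).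
  near=> n; have := @three_twos_integer n (m n) _ 0 (achievement0 ks q).
  rewrite addr0; apply.
  rewrite /m truncn_lt_nat// truncn_ge_nat//; apply/andP; split; last first.
    rewrite natrX ltr_pdivrMr// mulrC ltr_pM2l ?exprn_gt0//.
    by apply: lt_le_trans y4 _; rewrite ler_nat.
  rewrite ler_pdivlMr// -natrX.
  have := predn_exp N n; set S := (\sum_(i < n) _)%N => PS.
  have P0 : (0 < N ^ n)%N by rewrite expn_gt0; lia.
  have : (3 * (N ^ n) )%:R <= y * (N ^ n)%:R by rewrite natrM ler_pM2r// ltr0n.
  apply: le_trans; rewrite -natrM ler_nat.
  move: PS P0; move: (N ^ n)%N => P; move: N4; set M := N => M4.
  by case: P => //= P -> _; case: M M4 => // M M4 /=; nia.
apply/cvgrPdist_le => e e0.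
near=> n.
have qn0 : 0 < q ^+ n by rewrite exprn_gt0.
have NqX : N%:R ^+ n * q ^+ n = 1 by rewrite -exprMn Nq expr1n.
have yE : y = y * N%:R ^+ n / N%:R * (N%:R * q ^+ n).
  by rewrite mulrA divfK ?gt_eqF// -mulrA NqX mulr1.
have Nqn0 : 0 < N%:R * q ^+ n by rewrite mulr_gt0.
have /andP[] := truncn_itv (yN n); rewrite -/(m n) -natr1 => lo hi.
rewrite {1}yE -[X in _ - X]mulrA -mulrBl normrM (gtr0_norm Nqn0).
apply: (@le_trans _ _ (1 * (N%:R * q ^+ n))).
  by rewrite ler_pM2r// ler_norml; lra.
rewrite mul1r mulrC -ler_pdivlMr//; apply: ltW; near: n.
by apply: expr_q_small => //; exact: divr_gt0.
Unshelve. all: by end_near. Qed.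

Lemma three_twos_regclosed : closure (interior E) = E.
Proof.
apply: achievement_regclosed => //; exists (7 / 2).
apply/nbhs_ballP; exists (1 / 2) => //= y.
by rewrite /ball/= ltr_norml => yb; apply: three_twos_interior; lra.
Qed.

Lemma three_twos_left_gap_end : left_gap_end E `<=` singleton_components E.
Proof.
apply: (@left_gap_end_singleton _ cs _ (11 / 6)) => //; first lia.
  apply/andP; split; first lra.
  have : 4%:R <= N%:R :> R by rewrite ler_nat; lia.
  by lra.
exact: three_twos_hole.
Qed.

End ThreeTwos.

Theorem theorem8 (R : realType) (k : nat) (hk : (0 < k)%N) :
  cantorval (achievement_set
    (multigeometric (3 :: nseq k 2) (1 / (2 * k%:R + 2) : R))).
Proof.
have -> : multigeometric (3 :: nseq k 2) (1 / (2 * k%:R + 2) : R) =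
    multigeometric [seq c%:R | c <- (3 :: nseq k 2)%N] (2 * k + 2)%:R^-1.
  by rewrite /= map_nseq div1r natrD natrM.
set E := achievement_set _.
have sx := three_twos_summable R hk.
have cE : compact E by exact: achievement_compact.
have symE s : E s -> E (limn (series (multigeometric
    [seq c%:R | c <- (3 :: nseq k 2)%N] (2 * k + 2)%:R^-1)) - s).
  exact: achievement_sym.
have gapE := @three_twos_left_gap_end R k hk.
split=> //.
- by exists 3; apply: three_twos_interior => //; lra.
- exact: three_twos_regclosed.
- move=> x Ex iC; split; first exact: inf_component_limit_point.
  exact: (sup_component_limit_point cE symE).
Qed.
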